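(* Let $f=u+iv$ with $u,v\in C_0^\infty(\mathbb R^n)$ real-valued. Then $$\int_{\mathbb R^n} |\nabla f(x)|^2\, dx \int_{\mathbb R^n}|x|^2|f(x)|^2\, dx \;\geq\; \frac{n^2}{4}\left(\int_{\mathbb R^n} |f(x)|^2\,dx\right)^2 +\mathrm{COV}^2,$$ where $$\mathrm{COV}=\int_{\mathbb R^n}|f(x)|^2\,|x|\,\left|\Phi_f'(x)\right| dx .$$
   Context: $C_0^\infty(\mathbb R^n)$ denotes the smooth functions with compact support in $\mathbb R^n$. $\nabla=(\partial_1,\dots,\partial_n)^T$ is the gradient, and for complex-valued $f$, $|\nabla f(x)|$ is the Hermitian norm in $\mathbb C^n$, i.e. $|\nabla f|^2=|\nabla u|^2+|\nabla v|^2$. Phase derivative of a complex-valued function $f=u+iv$ on $\mathbb R^n$: at points where $f(x)\neq 0$, $$\Phi_f'(x)=\frac{\nabla f(x)}{2i f(x)}-\frac{\nabla \overline{f(x)}}{2i\,\overline{f(x)}}=\frac{u(x)\nabla v(x)-v(x)\nabla u(x)}{|f(x)|^2}\in\mathbb R^n .$$ Integrands containing the product of a positive power of $|f(x)|$ with $\Phi_f'(x)$ are taken to be $0$ at points where $f(x)=0$. *)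

(* Defs.v *)
From HB Require Import structures.
From mathcomp Require Import all_boot all_order all_algebra.
From mathcomp Require Import all_classical all_reals all_analysis.
From mathcomp.real_closed Require Import complex.
From mathcomp Require Import ring.
Set Implicit Arguments.
Unset Strict Implicit.
Unset Printing Implicit Defensive.
Import Order.TTheory GRing.Theory Num.Theory.
Import numFieldNormedType.Exports.
Local Open Scope classical_set_scope.
Local Open Scope ring_scope.

Definition measure_rV_display : measure_display -> measure_display.
Proof. exact. Qed.

(* The Borel sigma-algebra of 'rV[R]_n, generated by the coordinate functions
   as the library does for n.-tuple R. *)
Section measurable_rV.
Variables (R : realType) (n : nat).

Definition rV_coord (i : 'I_n) (x : 'rV[R]_n) : measurableTypeR R := x 0 i.

Let rV_set0 : g_sigma_preimage rV_coord set0.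
Proof. exact: sigma_algebra0. Qed.

Let rV_setC A : g_sigma_preimage rV_coord A ->
  g_sigma_preimage rV_coord (~` A).
Proof. exact: sigma_algebraC. Qed.

Let rV_bigcup (F : (set 'rV[R]_n)^nat) :
  (forall i, g_sigma_preimage rV_coord (F i)) ->
  g_sigma_preimage rV_coord (\bigcup_i (F i)).
Proof. exact: sigma_algebra_bigcup. Qed.

HB.instance Definition _ := @isMeasurable.Build
  (measure_rV_display R.-ocitv.-measurable.-sigma)
  'rV[R]_n (g_sigma_preimage rV_coord) rV_set0 rV_setC rV_bigcup.

End measurable_rV.

Section measurable_rV_theory.
Variable R : realType.

Lemma measurable_rV_coord n (i : 'I_n) :
  measurable_fun [set: 'rV[R]_n] (rV_coord i).
Proof.
move=> _ Y mY; rewrite setTI; apply: sub_sigma_algebra => /=.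
rewrite -bigcup_seq/=; exists i => /=; first by rewrite mem_index_enum.
by exists Y => //; rewrite setTI.
Qed.

Lemma measurable_fun_rVP d (T : measurableType d) n (f : T -> 'rV[R]_n) :
  measurable_fun [set: T] f <->
  forall i, measurable_fun [set: T] (rV_coord i \o f).
Proof.
split=> [mf i|mf].
  by apply: measurableT_comp => //; exact: measurable_rV_coord.
move=> _; apply: (@measurability _ _ _ _ _ _
  (\big[setU/set0]_(i < n)
     preimage_set_system setT (@rV_coord R n i) measurable)) => //.
move=> _ [B + <-]; rewrite -bigcup_seq => -[i _ [C mC <-]].
by rewrite !setTI; have := mf i measurableT C mC; rewrite setTI.
Qed.

Definition rV_cons n (p : measurableTypeR R * 'rV[R]_n) : 'rV[R]_n.+1 :=
  row_mx p.1%:M p.2.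

Definition rV_uncons n (x : 'rV[R]_n.+1) : measurableTypeR R * 'rV[R]_n :=
  (x 0 ord0, \row_j x 0 (lift ord0 j)).

Lemma rV_cons0 n (p : measurableTypeR R * 'rV[R]_n) : rV_cons p 0 ord0 = p.1.
Proof.
have -> : ord0 = lshift n (ord0 : 'I_1) by exact/val_inj.
by rewrite [LHS](row_mxEl (p.1%:M : 'M[R]_1)) mxE eqxx.
Qed.

Lemma rV_cons_lift n (p : measurableTypeR R * 'rV[R]_n) j :
  rV_cons p 0 (lift ord0 j) = p.2 0 j.
Proof.
have -> : lift ord0 j = rshift 1 j by exact/val_inj.
exact: (row_mxEr (p.1%:M : 'M[R]_1)).
Qed.

Lemma rV_consK n : cancel (@rV_cons n) (@rV_uncons n).
Proof.
move=> p; rewrite /rV_uncons rV_cons0 [RHS]surjective_pairing; congr pair.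
by apply/rowP => j; rewrite mxE rV_cons_lift.
Qed.

Lemma measurable_rV_cons n : measurable_fun [set: _] (@rV_cons n).
Proof.
apply/measurable_fun_rVP => i.
have [j ->|->] := unliftP ord0 i.
  rewrite (_ : _ \o _ = rV_coord j \o snd); last first.
    by apply/funext => p /=; rewrite /rV_coord rV_cons_lift.
  by apply: measurableT_comp => //; exact: measurable_rV_coord.
rewrite (_ : _ \o _ = fst) //.
by apply/funext => p /=; rewrite /rV_coord rV_cons0.
Qed.

Lemma measurable_rV_uncons n : measurable_fun [set: _] (@rV_uncons n).
Proof.
apply/measurable_fun_pairP; split.
  exact: (@measurable_rV_coord n.+1 ord0).
apply/measurable_fun_rVP => j.
rewrite (_ : _ \o _ = rV_coord (lift ord0 j)).
  exact: measurable_rV_coord.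
by apply/funext => x; rewrite /rV_coord /= mxE.
Qed.

End measurable_rV_theory.

(* Lebesgue measure on R^n, as the n-fold product of the Lebesgue measure. *)
Section lebesgue_rV.
Variable R : realType.
Local Open Scope ereal_scope.

Section step.
Variables (n : nat) (mu : {sigma_finite_measure set 'rV[R]_n -> \bar R}).

Definition lebesgue_rVS : set 'rV[R]_n.+1 -> \bar R :=
  pushforward (@lebesgue_measure R \x mu) (@rV_cons R n).

Let lebesgue_rVS0 : lebesgue_rVS set0 = 0.
Proof. by rewrite /lebesgue_rVS /pushforward preimage_set0 measure0. Qed.

Let lebesgue_rVS_ge0 A : 0 <= lebesgue_rVS A.
Proof. by rewrite /lebesgue_rVS /pushforward measure_ge0. Qed.

Let lebesgue_rVS_sigma_additive : semi_sigma_additive lebesgue_rVS.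
Proof.
exact: (@measure_semi_sigma_additive _ _ _
  (measure_function_pushforward__canonical__measure_function_Measure
    (@lebesgue_measure R \x mu) (@measurable_rV_cons R n))).
Qed.

HB.instance Definition _ := isMeasure.Build _ _ _ lebesgue_rVS
  lebesgue_rVS0 lebesgue_rVS_ge0 lebesgue_rVS_sigma_additive.

Let lebesgue_rVS_sigma_finite : sigma_finite setT lebesgue_rVS.
Proof.
have /sigma_finiteP[F [FT ndF Foo]] := sigma_finiteT (@lebesgue_measure R).
have /sigma_finiteP[G [GT ndG Goo]] := sigma_finiteT mu.
exists (fun i => @rV_uncons R n @^-1` (F i `*` G i)).
  apply/seteqP; split=> // x _.
  have [k _ Fk] : (\bigcup_k F k) (rV_uncons x).1 by rewrite -FT.
  have [l _ Gl] : (\bigcup_l G l) (rV_uncons x).2 by rewrite -GT.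
  exists (maxn k l) => //; split.
    by apply: subsetPset (ndF _ _ (leq_maxl k l)) _ Fk.
  by apply: subsetPset (ndG _ _ (leq_maxr k l)) _ Gl.
move=> i; have [mF Fi] := Foo i; have [mG Gi] := Goo i; split.
  rewrite -[X in measurable X]setTI.
  by apply: measurable_rV_uncons => //; exact: measurableX.
rewrite /lebesgue_rVS /pushforward -comp_preimage.
rewrite (_ : _ \o _ = id); last by apply/funext => p; exact: rV_consK.
by rewrite preimage_id product_measure1E// lte_mul_pinfty// ge0_fin_numE.
Qed.

HB.instance Definition _ := Measure_isSigmaFinite.Build _ _ _ lebesgue_rVS
  lebesgue_rVS_sigma_finite.

End step.

Fixpoint lebesgue_rV n : {sigma_finite_measure set 'rV[R]_n -> \bar R} :=
  match n with
  | 0%N => @dirac _ 'rV[R]_0 0%R R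
  | n'.+1 => lebesgue_rVS (lebesgue_rV n')
  end.

Lemma lebesgue_rV_box n (A : 'I_n -> set (measurableTypeR R)) :
  (forall i, measurable (A i)) ->
  lebesgue_rV n [set x | forall i, A i (x 0%R i)] =
  \prod_(i < n) lebesgue_measure (A i).
Proof.
elim: n A => [|n IHn] A mA.
  by rewrite big_ord0 /= diracE mem_set // => -[].
rewrite big_ord_recl -IHn //= /lebesgue_rVS /pushforward.
have mB : measurable [set x : 'rV[R]_n | forall i, A (lift ord0 i) (x 0%R i)].
  rewrite (_ : mkset _ = \big[setI/setT]_(i < n) (rV_coord i @^-1` A (lift ord0 i))).
    apply: bigsetI_measurable => i _; rewrite -[X in measurable X]setTI.
    exact: measurable_rV_coord.
  rewrite -bigcap_seq; apply/seteqP; split=> x /= xA i.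
    by move=> _; exact: xA.
  by apply: xA; rewrite /= mem_index_enum.
rewrite -product_measure1E //; congr (_ _).
apply/seteqP; split=> p /=.
  move=> pA; split=> [|i]; first by rewrite -(rV_cons0 p); exact: pA.
  by rewrite -(rV_cons_lift p); exact: pA.
move=> [p1 p2] i; have [j ->|->] := unliftP ord0 i.
  by rewrite rV_cons_lift.
by rewrite rV_cons0.
Qed.

End lebesgue_rV.

Section smooth.
Variables (R : realType) (n : nat).
Implicit Type u : 'rV[R]_n -> R.

Definition partial (i : 'I_n) u : 'rV[R]_n -> R :=
  fun x => 'D_(delta_mx 0 i) u x.

Definition partials (s : seq 'I_n) u : 'rV[R]_n -> R := foldr partial u s.

(* All the partial derivatives of all orders exist and are continuous; the
   existence has to be asserted since 'D is total. *)
Definition smooth u := forall s : seq 'I_n,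
  continuous (partials s u) /\
  forall i x, derivable (partials s u) x (delta_mx 0 i).

Definition compactly_supported u := compact (closure [set x | u x != 0]).

Definition C0infty u := smooth u /\ compactly_supported u.

Definition grad u (x : 'rV[R]_n) : 'rV[R]_n := \row_i partial i u x.

End smooth.

Section phase_derivative.
Variables (R : realType) (n : nat).
Local Notation C := R[i].
Implicit Types (x : 'rV[R]_n) (f : 'rV[R]_n -> C).

(* The norm `|x| of 'rV[R]_n is the maximum norm. *)
Definition enorm x : R := Num.sqrt (\sum_i x 0 i ^+ 2).

(* `|z| is R[i]-valued; this is the same modulus as an element of R. *)
Definition cabs (z : C) : R := Normc.normc z.

Definition hnorm (z : 'rV[C]_n) : R := Num.sqrt (\sum_i cabs (z 0 i) ^+ 2).

Definition cgrad f x : 'rV[C]_n :=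
  \row_i Complex (partial i (fun y => complex.Re (f y)) x)
                 (partial i (fun y => complex.Im (f y)) x).

(* Phi_f' := grad f / (2 i f) - grad (conj f) / (2 i conj f).  It is real where
   f does not vanish, see phase_derivE below. *)
Definition phase_deriv f x : 'rV[C]_n :=
  (2 * 'i%C * f x)^-1 *: cgrad f x -
  (2 * 'i%C * conjc (f x))^-1 *: cgrad (fun y => conjc (f y)) x.

Definition COV f : \bar R :=
  (\int[lebesgue_rV R n]_x
    (if f x == 0%R then 0%R
     else (cabs (f x) ^+ 2 * enorm x * hnorm (phase_deriv f x))%R)%:E)%E.

Lemma cabs_sqr (z : C) : cabs z ^+ 2 = complex.Re z ^+ 2 + complex.Im z ^+ 2.
Proof. by case: z => a b /=; rewrite sqr_sqrtr// addr_ge0 ?sqr_ge0. Qed.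

Lemma enorm_sqr x : enorm x ^+ 2 = \sum_i x 0 i ^+ 2.
Proof. by rewrite sqr_sqrtr// sumr_ge0// => i _; rewrite sqr_ge0. Qed.

Lemma hnorm_cgrad (u v : 'rV[R]_n -> R) x :
  hnorm (cgrad (fun y => Complex (u y) (v y)) x) ^+ 2 =
  enorm (grad u x) ^+ 2 + enorm (grad v x) ^+ 2.
Proof.
rewrite !enorm_sqr sqr_sqrtr; last by apply: sumr_ge0 => i _; rewrite sqr_ge0.
by rewrite -big_split; apply: eq_bigr => i _; rewrite cabs_sqr !mxE.
Qed.

Lemma phase_derivE (u v : 'rV[R]_n -> R) x (f := fun y => Complex (u y) (v y)) :
  smooth v -> f x != 0 ->
  phase_deriv f x = map_mx (real_complex R)
    ((cabs (f x) ^+ 2)^-1 *: (u x *: grad v x - v x *: grad u x)).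
Proof.
move=> sv fx0; apply/rowP => i.
have dv : derivable v x (delta_mx 0 i) by have [_] := sv [::]; apply.
have fxE : f x = Complex (u x) (v x) by [].
have n2_neq0 : u x ^+ 2 + v x ^+ 2 != 0.
  apply: contra fx0; rewrite fxE paddr_eq0 ?sqr_ge0// !sqrf_eq0 eq_complex.
  by [].
rewrite cabs_sqr !mxE /partial /= deriveN //.
set a := u x in n2_neq0 *; set b := v x in n2_neq0 *.
set a' := 'D__ u x; set b' := 'D__ v x.
have two : 2 = Complex 2 0 :> C.
  by rewrite -[LHS](rmorph_nat (real_complex R)).
have n4_neq0 : (2 * b) ^+ 2 + (2 * a) ^+ 2 != 0.
  by rewrite !exprMn -mulrDr addrC mulf_neq0 ?expf_neq0 ?pnatr_eq0.
have -> : 2 * 'i%C * f x = Complex (- (2 * b)) (2 * a).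
  by rewrite fxE two; apply/eqP; rewrite eq_complex /= -/a -/b;
    apply/andP; split; apply/eqP; ring.
have -> : 2 * 'i%C * Complex a (- b) = Complex (2 * b) (2 * a).
  by rewrite two; apply/eqP; rewrite eq_complex /=;
    apply/andP; split; apply/eqP; ring.
apply/eqP; rewrite eq_complex /= sqrrN; apply/andP; split; apply/eqP.
  by field; rewrite n2_neq0 n4_neq0.
by rewrite mulrN !mulNr subrr.

Qed.

Lemma hnorm_real x : hnorm (map_mx (real_complex R) x) = enorm x.
Proof.
by congr Num.sqrt; apply: eq_bigr => i _; rewrite cabs_sqr mxE/= expr0n addr0.
Qed.

End phase_derivative.

(* Main.v *)
Require Import Defs.
From mathcomp Require Import all_boot all_order all_algebra.
From mathcomp Require Import all_classical all_reals all_analysis.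
From mathcomp Require Import measurable_realfun.
From mathcomp.real_closed Require Import complex.
From mathcomp Require Import ring lra.
Import Order.TTheory GRing.Theory Num.Theory.
Import numFieldNormedType.Exports.
Local Open Scope ring_scope.

(** Write [w = u grad u + v grad v] and [z = u grad v - v grad u], the radial
    and angular parts of [conj f * grad f].  Where [f] does not vanish, [z] is
    [|f|^2] times the phase derivative, and where [f] vanishes so does [z];
    hence COV is the integral of [|x| |z|], with a continuous integrand of
    compact support ([COV_density]).  On the other hand [2 w] is the gradient
    of [|f|^2], so integrating by parts in each coordinate gives
    [\int x . w = - (n / 2) \int |f|^2] ([integral_radial_moment]).

    The two parts share the energy, [|w|^2 + |z|^2 = |f|^2 |grad f|^2]
    ([enorm_radial_angular]), which is why the two lower bounds add up.  With
    [P = (n / 2) \int |f|^2] and [Q = COV], the Cauchy-Schwarz inequality in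
    R^2 and in R^n followed by the inequality of arithmetic and geometric means
    yields, at every point and for every real [l],
    [2 l (- P (x . w) + Q |x| |z|)
       <= |grad f|^2 + l^2 (P^2 + Q^2) |x|^2 |f|^2]
    ([pointwise_bound]).  Integrating, the left-hand side becomes
    [2 l (P^2 + Q^2)], and a discriminant argument in [l]
    ([le_mul_of_quadratic]) leaves
    [P^2 + Q^2 <= (\int |grad f|^2) (\int |x|^2 |f|^2)].  Quantifying over [l]
    plays the part of the Cauchy-Schwarz inequality for integrals.

    The integration by parts rests on the vanishing of the integral of a
    partial derivative of a compactly supported function
    ([integral_partial_eq0]).  Lebesgue measure being an iterated product that
    splits off the first coordinate, this is an induction on the dimension:
    Fubini's theorem reduces it either to the fundamental theorem of calculus
    in the first coordinate or to a function of one variable less. *)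

Set Implicit Arguments.
Unset Strict Implicit.
Unset Printing Implicit Defensive.
Local Open Scope classical_set_scope.

(** * Measurability of continuous functions on R^n *)

Section measurability_rV.
Variables (R : realType) (n : nat).
Implicit Types (U : set 'rV[R]_n) (g : 'rV[R]_n -> R).

Lemma measurable_rV_box (A : 'I_n -> set (measurableTypeR R)) :
  (forall i, measurable (A i)) ->
  measurable [set x : 'rV[R]_n | forall i, A i (x 0 i)].
Proof.
move=> mA; rewrite (_ : mkset _ =
  \big[setI/setT]_(i < n) (rV_coord i @^-1` A i)).
  apply: bigsetI_measurable => i _; rewrite -[X in measurable X]setTI.
  exact: measurable_rV_coord.
rewrite -bigcap_seq; apply/seteqP; split=> x /= xA i.
  by move=> _; exact: xA.
by apply: xA; rewrite /= mem_index_enum.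
Qed.

(** Open boxes with rational corners form a countable base. *)
Lemma open_measurable_rV U : open U -> measurable U.
Proof.
move=> oU.
pose Q (ab : 'rV[rat]_n * 'rV[rat]_n) : set 'rV[R]_n :=
  [set x | forall i, `]ratr (ab.1 0 i), ratr (ab.2 0 i)[%classic (x 0 i)].
rewrite (_ : U = \bigcup_ab (if `[< Q ab `<=` U >] then Q ab else set0)).
  apply: countable_bigcupT_measurable => [|ab]; first exact: countableP.
  case: ifP => // _.
  apply: (@measurable_rV_box
    (fun i => `]ratr (ab.1 0 i), ratr (ab.2 0 i)[%classic)) => i.
  exact: measurable_itv.
apply/seteqP; split=> [x Ux|x [ab _]]; last by case: ifPn => // /asboolP; exact.
have [P xP PU] : nbhs x U by exact: open_nbhs_nbhs.
have ratP i : exists ab : rat * rat,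
    (ratr ab.1 < x 0 i < ratr ab.2) /\
    (`]ratr ab.1, ratr ab.2[%classic `<=` P 0 i).
  have /nbhs_ballP[e /= e0 xeP] := xP 0 i.
  have [a] := @rat_in_itvoo R (x 0 i - e) (x 0 i) ltac:(lra).
  have [b] := @rat_in_itvoo R (x 0 i) (x 0 i + e) ltac:(lra).
  rewrite !in_itv /= => /andP[b1 b2] /andP[a1 a2].
  exists (a, b); rewrite a2 b1; split=> // y.
  rewrite /= in_itv => /= /andP[y1 y2]; apply: xeP.
  by rewrite /ball /= ltr_distlC; apply/andP; split; lra.
have [ab abP] := choice ratP.
exists (\row_i (ab i).1, \row_i (ab i).2) => //.
rewrite asboolT => [i|y Qy].
  by rewrite /= !mxE; case: (abP i).
apply: PU => i j; rewrite (ord1 i); case: (abP j) => _; apply.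
by have := Qy j; rewrite /= !mxE.
Qed.

Lemma continuous_measurable_rV g : continuous g ->
  measurable_fun [set: 'rV[R]_n] (g : 'rV[R]_n -> measurableTypeR R).
Proof.
move=> /continuousP cg.
apply: (measurability _ (measurable_realfun.RGenOpens.measurableE R)).
move=> _ [_ [a [b ->]] <-].
rewrite setTI; apply: open_measurable_rV; apply: cg; exact: interval_open.
Qed.

End measurability_rV.

(** * Continuous functions with compact support *)

(** Compactness of the support is expressed by vanishing outside a cube: this
    form restricts to slices, and cubes have an explicit measure. *)
Definition Cc (R : realType) n (g : 'rV[R]_n -> R) :=
  continuous g /\
  exists M : R,
    forall x : 'rV[R]_n, (exists i : 'I_n, M < `|x 0 i|) -> g x = 0.

Section Cc_theory.
Variables (R : realType) (n : nat).
Implicit Types (f g : 'rV[R]_n -> R).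
Local Notation mu := (lebesgue_rV R n).

Lemma CcD f g : Cc f -> Cc g -> Cc (fun x => f x + g x).
Proof.
move=> [cf [M fM]] [cg [N gN]]; split=> [x|]; first exact: cvgD (cf x) (cg x).
exists (Num.max M N) => x [j]; rewrite gt_max => /andP[Mx Nx].
by rewrite fM ?gN ?addr0 //; exists j.
Qed.

Lemma CcMl f g : continuous f -> Cc g -> Cc (fun x => f x * g x).
Proof.
move=> cf [cg [N gN]]; split=> [x|]; first exact: cvgM (cf x) (cg x).
by exists N => x xN; rewrite gN ?mulr0.
Qed.

Lemma CcZ (k : R) g : Cc g -> Cc (fun x => k * g x).
Proof. by apply: CcMl => x; exact: cst_continuous. Qed.

Lemma Cc0 : Cc (fun _ : 'rV[R]_n => 0).
Proof. by split=> [x|]; [exact: cst_continuous|exists 0]. Qed.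

Lemma Cc_sum (I : Type) (s : seq I) (F : I -> 'rV[R]_n -> R) :
  (forall i, Cc (F i)) -> Cc (fun x => \sum_(i <- s) F i x).
Proof.
move=> CF; elim: s => [|i s IHs].
  by under eq_fun do rewrite big_nil; exact: Cc0.
by under eq_fun do rewrite big_cons; exact: CcD.
Qed.

Lemma Cc_sqrt g : Cc g -> Cc (fun x => Num.sqrt (g x)).
Proof.
move=> [cg [N gN]]; split=> [x|].
  exact: (continuous_comp (cg x) (@sqrt_continuous R _)).
by exists N => x xN; rewrite gN ?sqrtr0.
Qed.

(** A continuous function is bounded on the cube, which has finite measure. *)
Lemma Cc_integrable g : Cc g -> mu.-integrable setT (EFin \o g).
Proof.
move=> [cg [M gM]].
pose A : set 'rV[R]_n := [set x | forall i, `[- M, M]%classic (x 0 i)].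
have mA : measurable A.
  apply: (@measurable_rV_box _ _ (fun=> `[- M, M]%classic)) => i.
  exact: measurable_itv.
have cA : compact A.
  apply: (@rV_compact _ _ (fun=> `[- M, M]%classic)) => i.
  exact: segment_compact.
have mg := continuous_measurable_rV cg.
have gA : EFin \o g = (EFin \o g) \_ A.
  apply/funext => x /=; rewrite patchE; case: ifPn => // xA.
  rewrite gM //; apply: contrapT => /forallNP xM; move: xA.
  rewrite notin_setE; apply => i /=; rewrite in_itv /= -ler_norml.
  by rewrite leNgt; apply/negP; exact: xM.
rewrite gA -integrable_mkcond //.
apply: measurable_bounded_integrable => //.
- change (mu A < +oo)%E; rewrite /A.
  rewrite (@lebesgue_rV_box R n (fun=> `[- M, M]%classic)) => [|i]; last first.
    exact: measurable_itv.
  rewrite ltey_eq; apply/orP; left.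
  elim/big_ind : _ => [//|x y|i _]; first exact: fin_numM.
  by rewrite lebesgue_measure_itv; case: ifP.
- exact: measurable_funTS.
- have : compact (g @` A).
    by apply: continuous_compact => //; exact: continuous_subspaceT.
  move=> /compact_bounded [K [Kr gK]]; exists K; split=> // K' /gK KK' x Ax /=.
  by apply: KK'; exists x.
Qed.

End Cc_theory.

Section C0infty_theory.
Variables (R : realType) (n : nat) (u : 'rV[R]_n -> R).
Hypothesis u_C0 : C0infty u.

Lemma C0infty_continuous : continuous u.
Proof. by case: u_C0 => su _; case: (su [::]). Qed.

Lemma C0infty_derivable i x : derivable u x (delta_mx 0 i).
Proof. by case: u_C0 => su _; case: (su [::]) => _; apply. Qed.

Lemma C0infty_Cc : Cc u.
Proof.
split; first exact: C0infty_continuous.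
case: u_C0 => _ /compact_bounded [M [Mr uM]]; exists (M + 1) => x [j Mx].
apply/eqP/negPn/negP => ux0.
have /uM : M < M + 1 by rewrite ltrDl.
move=> /(_ x (@subset_closure _ [set x | u x != 0] x ux0)).
apply/negP; rewrite -ltNge (lt_le_trans Mx) //.
rewrite [leRHS]/Num.norm /= mx_normrE; apply/bigmax_geP.
by right; exists (0, j).
Qed.

Lemma C0infty_partial_Cc i : Cc (partial i u).
Proof.
split; first by case: u_C0 => su _; case: (su [:: i]).
have [cu [M uM]] := C0infty_Cc.
exists M => x [j Mx]; rewrite /partial.
rewrite (@near_eq_derive _ _ _ u (cst 0)) ?derive_cst //.
have Mnear : nbhs x [set y : 'rV[R]_n | M < `|y 0 j|].
  have cx := cvg_norm (@coord_continuous R 1 n 0 j x).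
  exact: cvgr_gt (cx _) _ Mx.
by apply: filterS Mnear => y My; apply: uM; exists j.
Qed.

End C0infty_theory.

(** * Slices and Fubini's theorem *)

Section slices.
Variables (R : realType) (n : nat).
Implicit Types (g : 'rV[R]_n.+1 -> R) (t : R) (y : 'rV[R]_n).

Lemma rV_cons_continuous (p : R * 'rV[R]_n) :
  {for p, continuous (fun p => @rV_cons R n p)}.
Proof.
move=> B /= [P pP PB].
exists (P 0 ord0, [set y : 'rV[R]_n | forall j, P 0 (lift ord0 j) (y 0 j)]); first split => /=.
- by have := pP 0 ord0; rewrite rV_cons0.
- exists (fun _ j => P 0 (lift ord0 j)) => [i j|y yP j].
    by rewrite (ord1 i); have := pP 0 (lift ord0 j); rewrite rV_cons_lift.
  exact: yP.
move=> [t y] [/= Pt Py]; apply: PB => i j; rewrite (ord1 i).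
by have [k ->|->] := unliftP ord0 j; rewrite ?rV_cons_lift ?rV_cons0.
Qed.

Lemma rV_consl_continuous t : continuous (fun y => rV_cons (t, y)).
Proof.
move=> y; apply: (@continuous_comp _ _ _ (fun y => (t, y))).
  apply: (@cvg_pair _ _ _ (nbhs y) (nbhs t) (nbhs y) _ _ _ (fun=> t) id).
    exact: cst_continuous.
  exact: cvg_id.
exact: rV_cons_continuous.
Qed.

Lemma rV_consr_continuous y : continuous (fun t : R => rV_cons (t, y)).
Proof.
move=> t; apply: (@continuous_comp _ _ _ (fun t => (t, y))).
  apply: (@cvg_pair _ _ _ (nbhs t) (nbhs t) (nbhs y) _ _ _ id (fun=> y)).
    exact: cvg_id.
  exact: cst_continuous.
exact: rV_cons_continuous.
Qed.

Lemma Cc_slice g t : Cc g -> Cc (fun y => g (rV_cons (t, y))).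
Proof.
move=> [cg [M gM]]; split=> [y|].
  by apply: (@continuous_comp _ _ _ (fun y => rV_cons (t, y)));
    [exact: rV_consl_continuous|exact: cg].
exists M => y [j My]; apply: gM; exists (lift ord0 j).
by rewrite rV_cons_lift.
Qed.

Lemma rV_consDl t y (j : 'I_n) (h : R) :
  h *: delta_mx 0 (lift ord0 j) + rV_cons (t, y) =
  rV_cons (t, h *: delta_mx 0 j + y).
Proof.
apply/rowP => i; rewrite mxE [X in X + _]mxE [X in _ * X]mxE.
have [k ->|->] := unliftP ord0 i; rewrite ?rV_cons_lift ?rV_cons0 ?mxE /=.
  by rewrite (inj_eq (@lift_inj _ ord0)).
by rewrite mulr0 add0r.
Qed.

Lemma rV_consDr t y (h : R) :
  h *: delta_mx 0 ord0 + rV_cons (t, y) = rV_cons (h + t, y).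
Proof.
apply/rowP => i; rewrite mxE [X in X + _]mxE [X in _ * X]mxE.
have [k ->|->] := unliftP ord0 i; rewrite ?rV_cons_lift ?rV_cons0 ?mxE /=.
  by rewrite mulr0 add0r.
by rewrite mulr1.
Qed.

End slices.

Section fubini_rV.
Variables (R : realType) (n : nat) (g : 'rV[R]_n.+1 -> R).
Hypothesis Cg : Cc g.
Local Notation leb := (@lebesgue_measure R).
Local Notation mu := (lebesgue_rV R n).
Local Open Scope ereal_scope.

Let g_cons (p : measurableTypeR R * 'rV[R]_n) := (g (rV_cons p))%:E.

Let lebesgue_rVS_pushforward (f : 'rV[R]_n.+1 -> \bar R) :
  \int[lebesgue_rV R n.+1]_x f x =
  \int[pushforward (leb \x mu) (@rV_cons R n)]_x f x.
Proof. by []. Qed.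

Lemma Cc_cons_integrable : (leb \x mu).-integrable setT g_cons.
Proof.
have mg : measurable_fun [set: 'rV[R]_n.+1] (EFin \o g).
  by apply/measurable_EFinP; apply: continuous_measurable_rV; case: Cg.
apply/integrableP; split.
  exact: (measurableT_comp mg (@measurable_rV_cons R n)).
have /integrableP[_] := Cc_integrable Cg.
rewrite lebesgue_rVS_pushforward ge0_integral_pushforward //.
- exact: measurable_rV_cons.
- exact: measurableT_comp.
Qed.

Lemma integral_rVS : \int[lebesgue_rV R n.+1]_x (g x)%:E =
  \int[leb \x mu]_p g_cons p.
Proof.
rewrite lebesgue_rVS_pushforward (integral_pushforward (@measurable_rV_cons R n)) //.
- by apply/measurable_EFinP; apply: continuous_measurable_rV; case: Cg.
- exact: Cc_cons_integrable.
Qed.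

Lemma integral_rVS12 : \int[lebesgue_rV R n.+1]_x (g x)%:E =
  \int[leb]_t \int[mu]_y (g (rV_cons (t, y)))%:E.
Proof.
by rewrite integral_rVS -integral12_prod_meas1 //; exact: Cc_cons_integrable.
Qed.

Lemma integral_rVS21 : \int[lebesgue_rV R n.+1]_x (g x)%:E =
  \int[mu]_y \int[leb]_t (g (rV_cons (t, y)))%:E.
Proof.
by rewrite integral_rVS12 (Fubini Cc_cons_integrable).
Qed.

End fubini_rV.

(** * The integral of a partial derivative *)

Section integral_partial.
Variable R : realType.
Local Notation leb := (@lebesgue_measure R).

Lemma integral_derive1_eq0 (phi : R -> R) (M : R) :
  (forall t, derivable phi t 1) -> continuous phi^`()%classic ->
  (forall t, M < `|t| -> phi t = 0) ->
  (\int[leb]_t (phi^`()%classic t)%:E = 0)%E.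
Proof.
(* [K] exceeds [M] strictly, so that [phi] vanishes at both endpoints, and is
   positive, so that the interval is nondegenerate. *)
move=> dphi cphi' phi0; pose K := `|M| + 1.
have K0 : 0 < K by rewrite ltr_wpDl.
have MK : M < K by rewrite (le_lt_trans (ler_norm M)) ?ltrDl.
have phi'0 t : ~ (`[- K, K]%classic t) -> phi^`()%classic t = 0.
  move=> tK; rewrite derive1E (@near_eq_derive _ _ _ phi (cst 0)) ?derive_cst //.
  have Mnear : nbhs t [set s : R | M < `|s|].
    have h := @norm_continuous _ R t; apply: (cvgr_gt _ h).
    apply: (lt_trans MK); rewrite ltNge; apply/negP => tK'; apply: tK.
    by rewrite /= in_itv /= -ler_norml.
  by apply: filterS Mnear => s Ms; exact: phi0.
rewrite (_ : (fun t => _) =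
  (fun t => (phi^`()%classic t)%:E) \_ `[- K, K]); last first.
  apply/funext => t; rewrite patchE; case: ifPn => // /negP tK.
  by rewrite phi'0 // => tK'; apply: tK; rewrite inE.
rewrite -integral_mkcond (@continuous_FTC2 _ _ phi) //.
- by rewrite !phi0 ?subee // ?normrN ger0_norm // ltW.
- by rewrite gtrN.
- exact: continuous_subspaceT.
- have cphi t : {for t, continuous phi}.
    exact/differentiable_continuous/derivable1_diffP.
  split=> [t _||]; first exact: dphi.
  + by apply: cvg_at_right_filter; exact: (cphi (- K)).
  + by apply: cvg_at_left_filter; exact: (cphi K).
Qed.

Lemma partial_lift n (g : 'rV[R]_n.+1 -> R) (j : 'I_n) t y :
  partial (lift ord0 j) g (rV_cons (t, y)) =
  partial j (fun y => g (rV_cons (t, y))) y.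
Proof.
rewrite /partial /derive; apply: (congr1 (fun q : R -> R => lim (q @ 0^'))).
apply/funext => h /=.
by rewrite rV_consDl.
Qed.

Lemma derivable_lift n (g : 'rV[R]_n.+1 -> R) (j : 'I_n) t y :
  derivable g (rV_cons (t, y)) (delta_mx 0 (lift ord0 j)) =
  derivable (fun y => g (rV_cons (t, y))) y (delta_mx 0 j).
Proof.
apply: (congr1 (fun q : R -> R => cvg (q @ 0^'))).
apply/funext => h /=.
by rewrite rV_consDl.
Qed.

Lemma partial_ord0 n (g : 'rV[R]_n.+1 -> R) t y :
  partial ord0 g (rV_cons (t, y)) = (fun t => g (rV_cons (t, y)))^`()%classic t.
Proof.
rewrite derive1E /partial /derive; apply: (congr1 (fun q : R -> R => lim (q @ 0^'))).
apply/funext => h /=.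
by rewrite rV_consDr -[h in rV_cons (h + t, y)]mulr1.
Qed.

Lemma derivable_ord0 n (g : 'rV[R]_n.+1 -> R) t y :
  derivable g (rV_cons (t, y)) (delta_mx 0 ord0) =
  derivable (fun t : R => g (rV_cons (t, y))) t 1.
Proof.
apply: (congr1 (fun q : R -> R => cvg (q @ 0^'))).
apply/funext => h /=.
by rewrite rV_consDr -[h in rV_cons (h + t, y)]mulr1.
Qed.

(** The first coordinate is integrated innermost when it is the direction of
    differentiation, and outermost otherwise. *)
Lemma integral_partial_eq0 n (i : 'I_n) (g : 'rV[R]_n -> R) :
  Cc g -> Cc (partial i g) -> (forall x, derivable g x (delta_mx 0 i)) ->
  (\int[lebesgue_rV R n]_x (partial i g x)%:E = 0)%E.
Proof.
elim: n => [|n IHn] in i g *; first by case: i.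
move=> Cg Cg' dg; have [j ij|i0] := unliftP ord0 i.
  subst i; rewrite integral_rVS12 //; apply: integral0_eq => t _.
  under eq_integral do rewrite partial_lift.
  apply: IHn; first exact: Cc_slice.
    rewrite (_ : partial _ _ =
      (fun y => partial (lift ord0 j) g (rV_cons (t, y)))).
      exact: Cc_slice.
    by apply/funext => y; rewrite partial_lift.
  by move=> y; rewrite -derivable_lift; exact: dg.
subst i; rewrite integral_rVS21 //; apply: integral0_eq => y _.
under eq_integral do rewrite partial_ord0.
have [cg [M gM]] := Cg.
apply: (@integral_derive1_eq0 _ M).
- by move=> t; rewrite -derivable_ord0; exact: dg.
- rewrite (_ : _^`() = fun t => partial ord0 g (rV_cons (t, y))); last first.
    by apply/funext => t; rewrite partial_ord0.
  move=> t; apply: (@continuous_comp _ _ _ (fun t : R => rV_cons (t, y))).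
    exact: rV_consr_continuous.
  by case: Cg' => + _; apply.
- by move=> t Mt; apply: gM; exists ord0; rewrite rV_cons0.
Qed.

End integral_partial.

(** * The pointwise inequality *)

Section euclidean.
Variables (R : realType) (n : nat).
Implicit Types x y a b : 'rV[R]_n.

Lemma enorm_CauchySchwarz x y :
  (\sum_i x 0 i * y 0 i) ^+ 2 <= enorm x ^+ 2 * enorm y ^+ 2.
Proof.
rewrite !enorm_sqr; set d := \sum_i _ * _; set X := \sum_i x 0 i ^+ 2.
set Y := \sum_i _.
have X0 : 0 <= X by apply: sumr_ge0 => i _; exact: sqr_ge0.
have [X0'|Xn0] := eqVneq X 0.
  suff -> : d = 0 by rewrite X0' expr0n mul0r.
  apply: big1 => i _; suff -> : x 0 i = 0 by rewrite mul0r.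
  apply/eqP; rewrite -sqrf_eq0; apply/eqP.
  by apply: (psumr_eq0P _ X0') => // j _; exact: sqr_ge0.
(* Up to the factor [X], the component of [y] orthogonal to [x]. *)
have : 0 <= \sum_i (X * y 0 i - d * x 0 i) ^+ 2.
  by apply: sumr_ge0 => i _; exact: sqr_ge0.
have -> : \sum_i (X * y 0 i - d * x 0 i) ^+ 2 = X * (X * Y - d ^+ 2).
  rewrite (eq_bigr (fun i => X ^+ 2 * y 0 i ^+ 2 +
    (- (2 * X * d) * (x 0 i * y 0 i) + d ^+ 2 * x 0 i ^+ 2))); last first.
    by move=> i _; ring.
  by rewrite !big_split /= -!mulr_sumr -/d -/X -/Y; ring.
by rewrite pmulr_rge0 ?subr_ge0 // lt_def Xn0.
Qed.

Lemma enormZ (k : R) x : enorm (k *: x) = `|k| * enorm x.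
Proof.
rewrite /enorm; under eq_bigr do rewrite mxE exprMn.
by rewrite -mulr_sumr sqrtrM ?sqr_ge0 // sqrtr_sqr.
Qed.

(** The planar identity [|conj p * q|^2 = |p|^2 |q|^2] in each coordinate,
    with [p = s + i t] and [q] the corresponding entry of [a + i b]. *)
Lemma enorm_radial_angular (s t : R) a b :
  enorm (s *: a + t *: b) ^+ 2 + enorm (s *: b - t *: a) ^+ 2 =
  (s ^+ 2 + t ^+ 2) * (enorm a ^+ 2 + enorm b ^+ 2).
Proof.
rewrite !enorm_sqr -!big_split /= mulr_sumr; apply: eq_bigr => i _.
by rewrite !mxE; ring.
Qed.

(** The bracket [S] on the left satisfies [(l S)^2 <= G H], with [G] and [H]
    the two summands on the right: combine the Cauchy-Schwarz inequality for
    [(P, Q)] with [|x . w| <= |x| |w|] and [enorm_radial_angular].  Then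
    [2 l S <= G + H] by the inequality of arithmetic and geometric means. *)
Lemma pointwise_bound (P Q l s t : R) x a b :
  2 * l * (- P * (\sum_i x 0 i * (s *: a + t *: b) 0 i) +
           Q * (enorm x * enorm (s *: b - t *: a))) <=
  enorm a ^+ 2 + enorm b ^+ 2 +
  l ^+ 2 * (P ^+ 2 + Q ^+ 2) * (enorm x ^+ 2 * (s ^+ 2 + t ^+ 2)).
Proof.
set w := s *: a + t *: b; set z := s *: b - t *: a.
have := enorm_CauchySchwarz x w; set d := \sum_i _ => dw.
have := enorm_radial_angular s t a b; rewrite -/w -/z.
set G := enorm a ^+ 2 + _; set F := s ^+ 2 + _ => wz.
set H := l ^+ 2 * _ * _; set S := _ + Q * _.
have G0 : 0 <= G by rewrite addr_ge0 ?sqr_ge0.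
have F0 : 0 <= F by rewrite addr_ge0 ?sqr_ge0.
have H0 : 0 <= H.
  apply: mulr_ge0; apply: mulr_ge0 => //; rewrite ?sqr_ge0 //.
  by rewrite addr_ge0 ?sqr_ge0.
have S2 : S ^+ 2 <= (P ^+ 2 + Q ^+ 2) * (enorm x ^+ 2 * (F * G)).
  apply: (@le_trans _ _ ((P ^+ 2 + Q ^+ 2) * (d ^+ 2 + (enorm x * enorm z) ^+ 2))).
    (* Lagrange's identity in dimension two. *)
    rewrite -subr_ge0 (_ : _ - _ = (P * (enorm x * enorm z) + Q * d) ^+ 2).
      exact: sqr_ge0.
    by rewrite /S; ring.
  apply: ler_wpM2l; first by rewrite addr_ge0 ?sqr_ge0.
  by rewrite -wz mulrDr exprMn lerD2r.
have lS : (l * S) ^+ 2 <= G * H.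
  rewrite exprMn (_ : G * H =
    l ^+ 2 * ((P ^+ 2 + Q ^+ 2) * (enorm x ^+ 2 * (F * G)))); last first.
    by rewrite /H; ring.
  by apply: ler_wpM2l => //; exact: sqr_ge0.
rewrite -mulrA; apply: le_trans (ler_norm _) _.
rewrite -(@ler_pXn2r _ 2) ?nnegrE ?(addr_ge0 G0 H0) //.
rewrite real_normK ?num_real // exprMn.
have := sqr_ge0 (G - H).
nra.
Qed.

End euclidean.

(** * Integration by parts *)

Section integration_by_parts.
Variables (R : realType) (n : nat).
Local Notation mu := (lebesgue_rV R n).

Lemma Cc_integralE (g : 'rV[R]_n -> R) : Cc g ->
  (\int[mu]_x (g x)%:E)%E = (\int[mu]_x g x)%:E.
Proof.
move=> Cg; rewrite fineK //.
by apply: integrable_fin_num => //; exact: Cc_integrable.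
Qed.

Lemma is_derive_rV_coord (i : 'I_n) (x v : 'rV[R]_n) :
  is_derive x v (fun x : 'rV[R]_n => x 0 i) (v 0 i).
Proof.
have hlim : (fun h : R => h^-1 *: ((h *: v + x) 0 i - x 0 i)) @ 0^' --> v 0 i.
  apply: (@cvg_trans _ ((fun=> v 0 i) @ (0 : R)^')); last exact: cvg_cst.
  apply: near_eq_cvg; near=> h; rewrite !mxE addrK.
  by rewrite [RHS]mulKf //; near: h; exact: nbhs_dnbhs_neq.
by split; [exact: (cvgP _ hlim)|exact: cvg_lim hlim].
Unshelve. all: by end_near. Qed.

(** The [i]-th partial derivative of [x_i u^2] integrates to zero. *)
Lemma integral_coord_mul_partial (u : 'rV[R]_n -> R) (i : 'I_n) :
  C0infty u ->
  \int[mu]_x (x 0 i * (u x * partial i u x)) =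
  - 2^-1 * \int[mu]_x (u x ^+ 2).
Proof.
move=> hu.
have Cu := C0infty_Cc hu; have Cu' := C0infty_partial_Cc hu i.
have cu := C0infty_continuous hu.
have cx : continuous (fun x : 'rV[R]_n => x 0 i) by exact: coord_continuous.
pose g := (fun x : 'rV[R]_n => x 0 i) * (u * u).
have du x : derivable u x (delta_mx 0 i) by exact: C0infty_derivable.
have dg x : derivable g x (delta_mx 0 i).
  apply: derivableM; last exact: derivableM.
  by case: (is_derive_rV_coord i x (delta_mx 0 i)).
have Cuu : Cc (fun x => u x ^+ 2) by exact: CcMl.
have Cxu : Cc (fun x : 'rV[R]_n => x 0 i * (u x * partial i u x)).
  by apply: CcMl => //; exact: CcMl.
have g'E : partial i g =
    (fun x => 2 * (x 0 i * (u x * partial i u x)) + u x ^+ 2).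
  apply/funext => x; rewrite [LHS]/partial /g deriveM; last 2 first.
  - by case: (is_derive_rV_coord i x (delta_mx 0 i)).
  - exact: derivableM.
  rewrite deriveM //.
  rewrite (@derive_val _ _ _ _ _ _ _ (is_derive_rV_coord _ _ _)).
  rewrite mxE !eqxx.
  transitivity (x 0 i * (u x * partial i u x + u x * partial i u x) +
    u x * u x * 1); [by []|ring].
have : (\int[mu]_x (partial i g x)%:E = 0)%E.
  apply: integral_partial_eq0 => //.
  - by apply: CcMl => //; exact: CcMl.
  - by rewrite g'E; apply: CcD => //; exact: CcZ.
rewrite g'E Cc_integralE; last by apply: CcD => //; exact: CcZ.
move=> [].
rewrite RintegralD ?RintegralZl //; try exact: Cc_integrable; last first.
  by apply: Cc_integrable; exact: CcZ.
lra.
Qed.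

End integration_by_parts.

(** * Radial and angular parts of the gradient *)

Section phase.
Variables (R : realType) (n : nat) (u v : 'rV[R]_n -> R).
Hypotheses (hu : C0infty u) (hv : C0infty v).
Local Notation mu := (lebesgue_rV R n).
Local Notation radial x := (u x *: grad u x + v x *: grad v x).
Local Notation angular x := (u x *: grad v x - v x *: grad u x).

Lemma enorm_continuous : continuous (@enorm R n).
Proof.
move=> x; apply: (@continuous_comp _ _ _ (fun x : 'rV[R]_n => \sum_i x 0 i ^+ 2)).
  change ((fun y : 'rV[R]_n => \sum_i y 0 i ^+ 2) @ x --> \sum_i x 0 i ^+ 2).
  apply: (@cvg_big R _ +%R 0 xpredT add_continuous _ (nbhs x) _
    (fun i (y : 'rV[R]_n) => y 0 i ^+ 2) (fun i => x 0 i ^+ 2)) => i _.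
  have cx : (fun y : 'rV[R]_n => y 0 i) @ x --> x 0 i by exact: coord_continuous.
  by apply: (cvgM cx).
exact: sqrt_continuous.
Qed.

Lemma Cc_enorm_sqr (w : 'rV[R]_n -> 'rV[R]_n) :
  (forall i, Cc (fun x => w x 0 i)) -> Cc (fun x => enorm (w x) ^+ 2).
Proof.
move=> Cw; under eq_fun do rewrite enorm_sqr; apply: Cc_sum => i.
by apply: CcMl; [case: (Cw i)|].
Qed.

Lemma Cc_enorm (w : 'rV[R]_n -> 'rV[R]_n) :
  (forall i, Cc (fun x => w x 0 i)) -> Cc (fun x => enorm (w x)).
Proof.
move=> /Cc_enorm_sqr/Cc_sqrt.
by under eq_fun do rewrite sqrtr_sqr ger0_norm ?sqrtr_ge0 //.
Qed.

Lemma Cc_grad (s : 'rV[R]_n -> R) :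
  C0infty s -> forall i, Cc (fun x => grad s x 0 i).
Proof.
by move=> hs i; under eq_fun do rewrite mxE; exact: C0infty_partial_Cc.
Qed.

Lemma Cc_angular i : Cc (fun x => (angular x) 0 i).
Proof.
rewrite (_ : (fun x => _) =
  (fun x => u x * partial i v x + (-1) * (v x * partial i u x))).
  apply: CcD; last apply: CcZ; apply: CcMl;
   by [exact: C0infty_continuous|exact: C0infty_partial_Cc].
by apply/funext => x; rewrite !mxE mulN1r.
Qed.

(** Multiplying by [|f|^2] cancels the denominator of the phase derivative, so
    the density extends continuously to the zeros of [f]. *)
Lemma COV_density x :
  (if Complex (u x) (v x) == 0 then 0
   else cabs (Complex (u x) (v x)) ^+ 2 * enorm x *
        hnorm (phase_deriv (fun y => Complex (u y) (v y)) x)) =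
  enorm x * enorm (angular x).
Proof.
case: ifPn => [|fx0].
  rewrite eq_complex /= => /andP[/eqP -> /eqP ->].
  by rewrite !scale0r subr0 [enorm 0]/enorm big1 ?sqrtr0 ?mulr0 // => i _;
    rewrite mxE expr0n.
have F0 : 0 <= cabs (Complex (u x) (v x)) ^+ 2 by rewrite sqr_ge0.
have Fn0 : cabs (Complex (u x) (v x)) ^+ 2 != 0.
  move: fx0; apply: contra; rewrite cabs_sqr /= paddr_eq0 ?sqr_ge0 //.
  by rewrite !sqrf_eq0 eq_complex.
rewrite phase_derivE //; last by case: hv.
rewrite hnorm_real enormZ ger0_norm ?invr_ge0 //.
by rewrite mulrACA divff // mul1r.
Qed.

(** The divergence theorem for the vector field [|f|^2 x]. *)
Lemma integral_radial_moment :
  \int[mu]_x (\sum_i x 0 i * (radial x) 0 i) =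
  - (n%:R / 2) * \int[mu]_x (u x ^+ 2 + v x ^+ 2).
Proof.
have Cuu (s : 'rV[R]_n -> R) : C0infty s -> Cc (fun x => s x ^+ 2).
  by move=> hs; apply: CcMl; [exact: C0infty_continuous|exact: C0infty_Cc].
have Cxu (s : 'rV[R]_n -> R) i : C0infty s ->
    Cc (fun x : 'rV[R]_n => x 0 i * (s x * partial i s x)).
  move=> hs; apply: CcMl; first exact: coord_continuous.
  by apply: CcMl; [exact: C0infty_continuous|exact: C0infty_partial_Cc].
pose q i (x : 'rV[R]_n) :=
  x 0 i * (u x * partial i u x) + x 0 i * (v x * partial i v x).
have Cq i : Cc (q i) by apply: CcD; exact: Cxu.
have -> : (fun x : 'rV[R]_n => \sum_i x 0 i * (radial x) 0 i) =
    (fun x => \sum_i q i x).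
  apply/funext => x; apply: eq_bigr => i _.
  by rewrite !mxE mulrDr.
have -> (s : seq 'I_n) : \int[mu]_x (\sum_(i <- s) q i x) =
    \sum_(i <- s) \int[mu]_x (q i x).
  elim: s => [|i s IHs].
    by under eq_Rintegral do rewrite big_nil; rewrite big_nil Rintegral_cst // mul0r.
  under eq_Rintegral do rewrite big_cons.
  rewrite RintegralD // ?big_cons ?IHs //; apply: Cc_integrable => //.
  exact: Cc_sum.
rewrite (eq_bigr (fun=> - 2^-1 * \int[mu]_x (u x ^+ 2 + v x ^+ 2))).
  by rewrite sumr_const card_ord -mulr_natl; field.
move=> i _; rewrite !RintegralD //;
  try (apply: Cc_integrable; by [exact: Cuu|exact: Cxu]).
by rewrite !integral_coord_mul_partial // mulrDr.
Qed.

End phase.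

(** The discriminant condition for [A - 2 l S + l^2 S B >= 0], through the
    minimizing [l = 1 / B]. *)
Lemma le_mul_of_quadratic (R : realType) (A B S : R) : 0 <= A -> 0 <= B -> 0 <= S ->
  (forall l, 2 * l * S <= A + l ^+ 2 * S * B) -> S <= A * B.
Proof.
move=> A0 B0; rewrite le_eqVlt => /predU1P[<- _|S0 h]; first exact: mulr_ge0.
have [B0'|Bn0] := eqVneq B 0.
  (* The quadratic is affine in [l], so [l] large violates the bound. *)
  have := h ((A + 1) / (2 * S)); rewrite B0' !mulr0 addr0.
  by rewrite (_ : 2 * _ * S = A + 1); [lra|field; rewrite gt_eqF].
have {}B0 : 0 < B by rewrite lt_def Bn0.
have := h B^-1.
rewrite (_ : 2 * _ * S = 2 * (S / B)); last by ring.
rewrite (_ : _ * S * B = S / B); last by field.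
move=> h'; have : S / B <= A by lra.
by rewrite ler_pdivrMr.
Qed.

(** * The uncertainty inequality *)

Theorem theorem1p4 (R : realType) (n : nat) (u v : 'rV[R]_n -> R)
    (hu : C0infty u) (hv : C0infty v) :
  let f : 'rV[R]_n -> R[i] := fun x => Complex (u x) (v x) in
  let mu := lebesgue_rV R n in
  ((\int[mu]_x (hnorm (cgrad f x) ^+ 2)%:E) *
   (\int[mu]_x (enorm x ^+ 2 * cabs (f x) ^+ 2)%:E) >=
   (n%:R ^+ 2 / 4)%:E * (\int[mu]_x (cabs (f x) ^+ 2)%:E) ^+ 2 +
   (COV f) ^+ 2)%E.
Proof.
cbv zeta; set mu := lebesgue_rV R n.
pose F x := u x ^+ 2 + v x ^+ 2.
pose w x := u x *: grad u x + v x *: grad v x.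
pose z x := u x *: grad v x - v x *: grad u x.
pose G x := enorm (grad u x) ^+ 2 + enorm (grad v x) ^+ 2.
pose d (x : 'rV[R]_n) := \sum_i x 0 i * (w x) 0 i.
have CG : Cc G by apply: CcD; apply: Cc_enorm_sqr; exact: Cc_grad.
have Cu := C0infty_Cc hu; have Cv := C0infty_Cc hv.
have CF : Cc F by apply: CcD; apply: CcMl => //; exact: C0infty_continuous.
have CB : Cc (fun x => enorm x ^+ 2 * F x).
  apply: CcMl => // x; have cx := @enorm_continuous R n x.
  exact: (cvgM cx cx).
have CC : Cc (fun x => enorm x * enorm (z x)).
  apply: CcMl; first exact: enorm_continuous.
  by apply: Cc_enorm => i; exact: Cc_angular.
have Cd : Cc d.
  apply: Cc_sum => i; apply: CcMl; first exact: coord_continuous.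
  rewrite (_ : (fun x => _) =
    (fun x => u x * partial i u x + v x * partial i v x)).
    by apply: CcD; apply: CcMl;
      by [exact: C0infty_continuous|exact: C0infty_partial_Cc].
  by apply/funext => x; rewrite !mxE.
have dE : \int[mu]_x (d x) = - (n%:R / 2) * \int[mu]_x (F x).
  exact: integral_radial_moment.
have -> : COV (fun x => Complex (u x) (v x)) = (\int[mu]_x (enorm x * enorm (z x)))%:E.
  rewrite -Cc_integralE //; apply: eq_integral => x _; congr EFin.
  exact: COV_density.
rewrite (eq_integral (fun x => (F x)%:E)) => [|x _]; last by rewrite cabs_sqr.
rewrite [X in (_ <= X * _)%E](eq_integral (fun x => (G x)%:E)) => [|x _]; last first.
  by rewrite hnorm_cgrad.
rewrite [X in (_ <= _ * X)%E](eq_integral (fun x =>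
    (enorm x ^+ 2 * F x)%:E)) => [|x _]; last first.
  by rewrite cabs_sqr.
rewrite (Cc_integralE CG) (Cc_integralE CB) (Cc_integralE CF).
rewrite -!EFin_expe -!EFinM -EFinD lee_fin.
set A := \int[mu]_x G x; set B := \int[mu]_x (_ * F x).
set N := \int[mu]_x F x in dE *; set C := \int[mu]_x _.
have -> : n%:R ^+ 2 / 4 * N ^+ 2 = (n%:R / 2 * N) ^+ 2 by field.
set P := n%:R / 2 * N.
have F0 x : 0 <= F x by rewrite addr_ge0 ?sqr_ge0.
apply: le_mul_of_quadratic.
- by apply: Rintegral_ge0 => // x _; rewrite addr_ge0 ?sqr_ge0.
- by apply: Rintegral_ge0 => // x _; rewrite mulr_ge0 ?sqr_ge0.
- by rewrite addr_ge0 ?sqr_ge0.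
move=> l.
have Cl : Cc (fun x => 2 * l * (- P * d x + C * (enorm x * enorm (z x)))).
  by apply: CcZ; apply: CcD; exact: CcZ.
have Cr : Cc (fun x => G x + l ^+ 2 * (P ^+ 2 + C ^+ 2) * (enorm x ^+ 2 * F x)).
  by apply: CcD => //; exact: CcZ.
have : \int[mu]_x (2 * l * (- P * d x + C * (enorm x * enorm (z x)))) <=
    \int[mu]_x (G x + l ^+ 2 * (P ^+ 2 + C ^+ 2) * (enorm x ^+ 2 * F x)).
  apply: le_Rintegral => //; [exact: Cc_integrable..|move=> x _].
  exact: pointwise_bound.
have I := fun g (Cg : Cc g) => Cc_integrable Cg.
rewrite RintegralZl //; last by apply: I; apply: CcD; exact: CcZ.
rewrite RintegralD //; try by apply: I; exact: CcZ.
rewrite RintegralD //; try by apply: I => //; exact: CcZ.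
rewrite !RintegralZl //; try exact: I.
by rewrite dE -/N -/C -/A -/B [- (_ / _) * N]mulNr -/P mulrNN -!expr2.
Qed.
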